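(* Let $p$ be a prime number, $F$ a field, $X$ an indeterminate over $F$, $D_n=F[X^{\frac{1}{p^n}},X^{-\frac{1}{p^n}}]$ for each $n\in\mathbb{N}_0$ and $D=\bigcup_{n\in\mathbb{N}_0}D_n$. Let $m\in\mathbb{N}_0$ and let $f(X^{\frac{1}{p^m}})\in F[X^{\frac{1}{p^m}}]$ be a polynomial with $f(0)\neq 0$ that is irreducible in $D_m$. Then the following statements are equivalent. (1) $f(X^{\frac{1}{p^m}})$ is an irreducible element of $D$. (2) $f(X^{\frac{1}{p^m}})$ is an irreducible element of $E$, where $E=D_{m+2}$ if $p=2$ and $E=D_{m+1}$ if $p>2$. (3) $f(X^{\frac{1}{p^m}})$ is an irreducible element of $D_{m+k}$ for all $k\in\mathbb{N}_0$. In particular, if $F$ is algebraically closed, then $D$ has no irreducible element and each maximal ideal of $D$ is not invertible.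
   Context: $\mathbb{N}_0$ is the set of nonnegative integers. The elements $X^{1/p^n}$ are compatible roots of $X$, i.e. $(X^{1/p^{n+1}})^p=X^{1/p^n}$, so $D_n\subsetneq D_{n+1}$. The condition $f(0)\neq0$ means that the constant term of $f$ is nonzero. An ideal $I$ of a domain $D$ with quotient field $K$ is invertible if $II^{-1}=D$, where $I^{-1}=\{x\in K\mid xI\subseteq D\}$. *)

(* Defs.v *)
From HB Require Import structures.
From mathcomp Require Import all_boot all_order all_algebra.
From mathcomp Require Import classical_sets.

Set Implicit Arguments.
Unset Strict Implicit.
Unset Printing Implicit Defensive.

Import GRing.Theory.
Local Open Scope classical_set_scope.
Local Open Scope ring_scope.

(* The rings involved are subrings S of one ambient field K, so that inclusions
   between them, their union and their quotient fields are literal. *)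

Section Subrings.
Variable K : fieldType.
Implicit Types S I J M : set K.

Definition unit_in S : set K := [set a | S a /\ exists2 b, S b & a * b = 1].

Definition irreducible_in S : set K :=
  [set a | [/\ S a, a != 0, ~ unit_in S a &
     forall b c, S b -> S c -> a = b * c -> unit_in S b \/ unit_in S c]].

Definition quotient_field S : set K :=
  [set z | exists a b, [/\ S a, S b, b != 0 & z = a / b]].

Definition is_ideal S I : Prop :=
  [/\ I `<=` S, I 0, (forall a b, I a -> I b -> I (a + b)) &
      forall a b, S a -> I b -> I (a * b)].

Definition maximal_ideal S M : Prop :=
  [/\ is_ideal S M, M <> S &
      forall J, is_ideal S J -> M `<=` J -> J = M \/ J = S].

Definition ideal_mul I J : set K :=
  [set z | exists n (a b : 'I_n -> K),
     [/\ forall i, I (a i), forall i, J (b i) & z = \sum_(i < n) a i * b i]].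

Definition ideal_inv S I : set K :=
  [set z | quotient_field S z /\ forall a, I a -> S (z * a)].

Definition invertible_ideal S I : Prop := ideal_mul I (ideal_inv S I) = S.

End Subrings.

Section RootTower.
Variables (F K : fieldType) (iota : {rmorphism F -> K}).

(* f(y), with coefficients embedded in K along iota *)
Definition eval_at (y : K) (f : {poly F}) : K := (map_poly iota f).[y].

(* F[y, y^-1]: each Laurent polynomial in y is g(y) / y^k for some g and k *)
Definition laurent_ring (y : K) : set K :=
  [set z | exists (g : {poly F}) (k : nat), z = eval_at y g / y ^+ k].

(* x is a compatible system of p-power roots of an indeterminate:
   x 0 plays the role of X, and x n that of X^(1/p^n) *)
Definition root_tower (p : nat) (x : nat -> K) : Prop :=
  ~ algebraicOver iota (x 0) /\ forall n, x n.+1 ^+ p = x n.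

Definition D_ (x : nat -> K) (n : nat) : set K := laurent_ring (x n).

Definition D_infty (x : nat -> K) : set K := \bigcup_n D_ x n.

End RootTower.

(* Main.v *)
Require Import Defs.
From HB Require Import structures.
From mathcomp Require Import all_boot all_order all_algebra all_field.
From mathcomp Require Import boolp classical_sets.

Set Implicit Arguments.
Unset Strict Implicit.
Unset Printing Implicit Defensive.

Import GRing.Theory.
Local Open Scope classical_set_scope.
Local Open Scope ring_scope.

(* For g irreducible in F[Y] with root z, Capelli's theorem says that g(Y^p) is
   irreducible unless z is a p-th power in F(z).  Suppose that g(Y^p) is
   irreducible but g(Y^(p^2)) is not; then some h in F[Y] satisfies h^p = Y
   modulo g(Y^p).  Evaluating at the companion matrix of Y^p - z and taking
   determinants yields c in F(z) with c^p = (-1)^(p-1) z.  For p odd, c is a root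
   of g(Y^p) of degree at most deg g over F, a contradiction.  For p = 2 and
   g = f(Y^2), c^4 = z^2 is a root of f, so c is a root of f(Y^4) of degree at
   most 2 deg f; so f(Y^8) is irreducible as soon as f(Y^4) is.  Irreducibility
   in D_(m+k) of f(X^(1/p^m)), where f(0) is nonzero, is irreducibility of
   f(Y^(p^k)) in F[Y].

   If F is algebraically closed, f(Y^p) has degree at least 2, so is reducible.
   Since D is a Bezout domain, an invertible maximal ideal would be principal,
   with an irreducible generator. *)

(** * Substitution of Y^q for Y in polynomials over a field *)

Lemma size_comp_Xn (R : idomainType) (f : {poly R}) (q : nat) :
  (size (f \Po 'X^q)).-1 = ((size f).-1 * q)%N.
Proof. by rewrite size_comp_poly size_polyXn. Qed.

Lemma comp_poly_XnM (R : comNzRingType) (f : {poly R}) (a b : nat) :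
  (f \Po 'X^a) \Po 'X^b = f \Po 'X^(a * b).
Proof. by rewrite -comp_polyA comp_Xn_poly -exprM mulnC. Qed.

(** A nonconstant divisor d of f yields the nonconstant divisor d(Y^q) of f(Y^q), which is then
    associate to it; comparing degrees and cancelling q gives deg d = deg f. *)
Lemma irredp_comp_Xn_inv (F : fieldType) (f : {poly F}) (q : nat) :
  (0 < q)%N -> irreducible_poly (f \Po 'X^q) -> irreducible_poly f.
Proof.
move=> q_gt0 [sz1 irr]; have eqs d := size_comp_Xn d q.
have f_gt1 : (1 < size f)%N.
  by move: sz1; rewrite -!ltn_predRL eqs muln_gt0 => /andP[].
split=> // d d1 df.
have d0 : d != 0 by apply: contraTneq df => ->; rewrite dvd0p -size_poly_gt0 ltnW.
have d_gt1 : (1 < size d)%N by rewrite ltn_neqAle eq_sym d1 size_poly_gt0.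
have : d \Po 'X^q %= f \Po 'X^q.
  apply: irr; last exact: dvdp_comp_poly.
  have : (0 < (size (d \Po 'X^q)).-1)%N.
    by rewrite eqs muln_gt0 q_gt0 ltn_predRL d_gt1.
  by case: (size _) => [|[]].
move=> /eqp_size/(congr1 predn); rewrite !eqs => /eqP.
rewrite eqn_pmul2r // => /eqP e; rewrite -(dvdp_size_eqp df).
by rewrite -(ltn_predK f_gt1) -(ltn_predK d_gt1) e.
Qed.

Lemma irredp_dvdM (F : fieldType) (a u v : {poly F}) :
  irreducible_poly a -> a %| u * v -> (a %| u) || (a %| v).
Proof.
move=> irr; case: (boolP (a %| u)) => //=; rewrite -irreducible_poly_coprime //.
by move=> co; rewrite Gauss_dvdpr.
Qed.

(** * Capelli's criterion for g(Y^q), through a root of g in an extension *)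

Section RootsInExtensions.
Variables (F M : fieldType) (iota : {rmorphism F -> M}).
Implicit Types g t : {poly F}.

(** Otherwise g and t would be coprime over F, hence over M, and could not share the root b. *)
Lemma irredp_root_dvd g t (b : M) :
  irreducible_poly g -> root (map_poly iota g) b ->
  root (map_poly iota t) b -> g %| t.
Proof.
move=> irr gb tb; apply: contraTT gb; rewrite -irreducible_poly_coprime // => co.
apply: contraL tb => gb; apply: (@coprimep_root _ (map_poly iota g)) => //.
by rewrite coprimep_map.
Qed.

(* Write t(Y) = T(Y^q, Y) with T(Z, Y) of degree less than q in Y.  If Y^q - b
   divides t then T(b, Y) = 0, so g(Z) divides each coefficient of T. *)
Lemma dvd_comp_Xn g t (b : M) (q : nat) :
  irreducible_poly g -> root (map_poly iota g) b -> (0 < q)%N ->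
  'X^q - b%:P %| map_poly iota t -> g \Po 'X^q %| t.
Proof.
move=> irr gb q_gt0 dv.
pose A : {poly {poly F}} := 'X^q - ('X)%:P.
have Amon : A \is monic by exact: monicXnsubC.
have sA : size A = q.+1 by exact: size_XnsubC.
have tE := Pdiv.RingMonic.rdivp_eq Amon (t ^:P).
move: (Pdiv.Ring.rdivp _ _) (Pdiv.Ring.ltn_rmodpN0 (t ^:P) (monic_neq0 Amon)) tE.
move: (Pdiv.Ring.rmodp _ _) => T Q sT tE; rewrite sA ltnS in sT.
have [phi phiE] : exists phi : {rmorphism {poly F} -> M},
    forall u, phi u = (map_poly iota u).[b].
  by exists (horner_eval b \o map_poly iota).
have phiC c : phi c%:P = iota c by rewrite phiE map_polyC hornerC.
have phiX : phi 'X = b by rewrite phiE map_polyX hornerX.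
have T0 : map_poly phi T = 0.
  have : 'X^q - b%:P %| map_poly phi T.
    have := congr1 (map_poly phi) tE.
    rewrite -map_poly_comp (eq_map_poly phiC) rmorphD rmorphM /= => tE'.
    move: dv; rewrite tE' rmorphB rmorphXn /= map_polyX map_polyC /= phiX.
    by rewrite dvdp_addr // dvdp_mull.
  apply: contraTeq => T0; apply/negP => /(dvdp_leq T0); rewrite size_XnsubC //.
  by rewrite leqNgt ltnS (leq_trans (size_poly _ _)).
(* Setting Z = Y^q kills [A] and sends [t ^:P] back to t, so t is the sum of the T_i(Y^q) Y^i. *)
have -> : t = (map_poly (comp_poly 'X^q) T).['X].
  have := congr1 (fun P => (map_poly (comp_poly 'X^q) P).['X]) tE.
  rewrite -map_poly_comp (eq_map_poly (g := polyC)); last first.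
    by move=> c /=; rewrite comp_polyC.
  rewrite -/(comp_poly 'X t) comp_polyXr rmorphD rmorphM /= => ->.
  rewrite rmorphB rmorphXn /= map_polyX map_polyC /= comp_polyX.
  by rewrite hornerD hornerM !hornerE subrr mulr0 add0r.
rewrite horner_poly; apply: (big_ind (fun u => g \Po 'X^q %| u)) => [|u v|i _].
- exact: dvdp0.
- exact: dvdp_add.
apply: dvdp_mulr; apply: dvdp_comp_poly; apply: (irredp_root_dvd irr gb).
have := congr1 (fun P : {poly M} => P`_i) T0.
by rewrite coef_map coef0 /root -phiE => /eqP.
Qed.

(** Over M, Y^q - b divides g(Y^q), so being irreducible it divides one factor of any factorization
    over F; by [dvd_comp_Xn] all of g(Y^q) divides that factor. *)
Lemma irredp_comp_Xn g (b : M) (q : nat) :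
  irreducible_poly g -> root (map_poly iota g) b -> (0 < q)%N ->
  irreducible_poly ('X^q - b%:P) -> irreducible_poly (g \Po 'X^q).
Proof.
move=> irr gb q_gt0 irrb; have g_gt1 : (1 < size g)%N by case: irr.
have s_gt1 : (1 < size (g \Po 'X^q))%N.
  by rewrite -ltn_predRL size_comp_Xn muln_gt0 q_gt0 ltn_predRL g_gt1.
split=> // d d1 dg; have /dvdpP[r rE] := dg.
have : 'X^q - b%:P %| map_poly iota d * map_poly iota r.
  rewrite mulrC -rmorphM -rE /= map_comp_poly map_polyXn.
  have -> : 'X^q - b%:P = ('X - b%:P) \Po 'X^q.
    by rewrite comp_polyB comp_polyX comp_polyC.
  by apply: dvdp_comp_poly; rewrite dvdp_XsubCl.
case/(irredp_dvdM irrb)/orP => /(dvd_comp_Xn irr gb q_gt0) dv.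
  by rewrite /eqp dg.
(* If g(Y^q) divides the cofactor r, sizes force d to be constant, against [d1]. *)
have r0 : r != 0.
  by apply: contraTneq s_gt1 => r0; rewrite rE r0 mul0r size_poly0.
have d0 : d != 0.
  by apply: contraTneq s_gt1 => r0'; rewrite rE r0' mulr0 size_poly0.
have := dvdp_leq r0 dv; rewrite rE size_mul // => le.
by move: le d1; rewrite -size_poly_gt0 in d0; case: (size d) d0 => [//|[//|n]] _;
  rewrite !addnS /= -[X in (_ <= X)%N]addn0 -addnS leq_add2l.
Qed.

End RootsInExtensions.

(** * Companion matrices, determinants and p-th powers *)

Lemma det_exp (R : comNzRingType) (n : nat) (A : 'M[R]_n.+1) (k : nat) :
  \det (A ^+ k) = \det A ^+ k.
Proof.
elim: k => [|k IH]; first by rewrite !expr0 det1.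
by rewrite !exprS -[A * _]/(A *m _) det_mulmx IH.
Qed.

(** The companion matrix, with its dimension in the successor form that the matrix ring structure
    requires. *)
Lemma ex_char_poly (R : comNzRingType) (P : {poly R}) :
  P \is monic -> (1 < size P)%N ->
  exists n, n.+1 = (size P).-1 /\ exists C : 'M[R]_n.+1, char_poly C = P.
Proof.
move=> Pmon P_gt1; have := companionmxK Pmon.
move: (companionmx P); move: (size P) P_gt1 => [|[|n]] //= _ C CP.
by exists n; split=> //; exists C.
Qed.

(* If b were not a p-th power and u a monic factor of degree 0 < k < p of
   Y^p - b, the companion matrix C of u would satisfy C^p = b, whence
   det(C)^p = b^k with k prime to p. *)
Lemma irredp_XpsubC (F : fieldType) (p : nat) (b : F) :
  prime p -> (forall c, c ^+ p != b) -> irreducible_poly ('X^p - b%:P).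
Proof.
move=> pp nb; have p_gt0 := prime_gt0 pp.
have b0 : b != 0 by have := nb 0; rewrite expr0n gtn_eqF //= eq_sym.
have sb : size ('X^p - b%:P) = p.+1 by exact: size_XnsubC.
have Pn0 : 'X^p - b%:P != 0 by rewrite -size_poly_gt0 sb.
split; first by rewrite sb ltnS.
move=> d; wlog dmon : d / d \is monic.
  move=> W d1 dP.
  have d0 : d != 0 by apply: contraTneq dP => ->; rewrite dvd0p.
  have l0 : (lead_coef d)^-1 != 0 by rewrite invr_eq0 lead_coef_eq0.
  have := W ((lead_coef d)^-1 *: d); rewrite size_scale // (eqp_dvdl _ (eqp_scale _ l0)).
  rewrite (eqp_ltrans (eqp_scale _ l0)); apply => //.
  by rewrite monicE lead_coefZ mulVf // lead_coef_eq0.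
move=> d1 dP; have d0 := monic_neq0 dmon.
have d_gt1 : (1 < size d)%N by rewrite ltn_neqAle eq_sym d1 size_poly_gt0.
rewrite -(dvdp_size_eqp dP) sb eqn_leq -{1}sb (dvdp_leq Pn0 dP) /= leqNgt.
apply/negP => lt; have [n [nE [C CE]]] := ex_char_poly dmon d_gt1.
have : horner_mx C ('X^p - b%:P) = 0.
  by have /dvdpP[r ->] := dP; rewrite rmorphM /= -CE Cayley_Hamilton mulr0.
rewrite rmorphB rmorphXn /= horner_mx_X horner_mx_C => /eqP.
rewrite subr_eq0 => /eqP/(congr1 (fun X => \det X)); rewrite det_exp det_scalar => detE.
have co : coprime n.+1 p.
  rewrite coprime_sym prime_coprime // gtnNdvd // nE.
  by rewrite -ltnS (ltn_predK d_gt1).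
(* With k = [n.+1] and u k = v p + 1, the element det(C)^u / b^v has p-th power b. *)
have [u v uv _] := egcdnP p (ltn0Sn n).
rewrite (eqP co) in uv.
have := nb (\det C ^+ u / b ^+ v); rewrite expr_div_n -exprM mulnC exprM detE -!exprM.
rewrite mulnC uv exprD expr1 mulrAC divff ?mul1r ?eqxx //.
by rewrite expf_neq0.
Qed.

(** Let C have characteristic polynomial Y^p - b, which divides g(Y^p) over M. By Cayley-Hamilton
    h(C)^p = C, and c = det h(C) works since det C is (-1)^p times the constant term -b. *)
Lemma pth_power_of_dvdp (F M : fieldType) (iota : {rmorphism F -> M})
    (p : nat) (g h : {poly F}) (b : M) :
  (0 < p)%N -> root (map_poly iota g) b -> g \Po 'X^p %| h ^+ p - 'X ->
  exists c : M, c ^+ p = (-1) ^+ p * - b.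
Proof.
move=> p_gt0 gb gh.
have [||n [nE [C CE]]] := @ex_char_poly M ('X^p - b%:P).
- exact: monicXnsubC.
- by rewrite size_XnsubC.
have : horner_mx C (map_poly iota (h ^+ p - 'X)) = 0.
  have : 'X^p - b%:P %| map_poly iota (h ^+ p - 'X).
    apply: (@dvdp_trans _ (map_poly iota (g \Po 'X^p))); last by rewrite dvdp_map.
    have -> : 'X^p - b%:P = ('X - b%:P) \Po 'X^p.
      by rewrite comp_polyB comp_polyX comp_polyC.
    by rewrite map_comp_poly map_polyXn dvdp_comp_poly // dvdp_XsubCl.
  by move/dvdpP => [r ->]; rewrite rmorphM /= -CE Cayley_Hamilton mulr0.
rewrite size_XnsubC //= in nE.
rewrite !rmorphB !rmorphXn /= map_polyX horner_mx_X => /eqP; rewrite subr_eq0 => /eqP.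
move/(congr1 (fun X => \det X)); rewrite det_exp => detE.
exists (\det (horner_mx C (map_poly iota h))); rewrite detE.
have := char_poly_det C; rewrite CE; move: (\det C) => D; rewrite nE.
by rewrite coefB coefXn coefC eqxx (ltn_eqF p_gt0) sub0r => ->;
  rewrite mulrA -expr2 sqrr_sign mul1r.
Qed.

(** g divides the minimal polynomial of c, whose degree [F(c):F] is at most [L:F]. *)
Lemma irredp_root_size (F : fieldType) (L : fieldExtType F) (g : {poly F}) (c : L) :
  irreducible_poly g -> root (map_poly (in_alg L) g) c ->
  ((size g).-1 <= \dim {:L})%N.
Proof.
move=> irr gc; have /polyOver1P[h hE] := minPolyOver 1%AS c.
have h0 : h != 0.
  by rewrite -(map_poly_eq0 (in_alg L)) -hE monic_neq0 ?monic_minPoly.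
have gh : g %| h.
  by apply: (irredp_root_dvd irr gc); rewrite -hE root_minPoly.
have sh : size h = (adjoin_degree 1%AS c).+1.
  by rewrite -(size_map_poly (in_alg L)) -hE size_minPoly.
have := dvdp_leq h0 gh; rewrite sh => le.
apply: (@leq_trans (adjoin_degree 1%AS c)).
  by rewrite -ltnS (ltn_predK (irr.1)).
by have := dim_Fadjoin 1%AS c; rewrite dimv1 muln1 => <-; rewrite dimvS ?subvf.
Qed.

(** By Capelli, a root z of g has a p-th root in F(z); it is h(z) for some polynomial h, so h^p - Y
    vanishes at z. *)
Lemma irredp_comp_Xp_or (F : fieldType) (p : nat) (g : {poly F}) :
  prime p -> irreducible_poly g -> ~ irreducible_poly (g \Po 'X^p) ->
  exists h, g %| h ^+ p - 'X.
Proof.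
move=> pp irr nirr; have [L _ [z gz zL]] := irredp_FAdjoin irr.
have [c cz] : exists c : L, c ^+ p = z.
  apply: contrapT => nc; apply: nirr.
  apply: (irredp_comp_Xn irr gz (prime_gt0 pp)); apply: irredp_XpsubC => // c.
  by apply/eqP => cz; apply: nc; exists c.
have : c \in <<1; z>>%VS by rewrite zL memvf.
case/Fadjoin_polyP => q /polyOver1P[h ->] cE; exists h.
apply: (irredp_root_dvd irr gz).
by rewrite /root !rmorphB !rmorphXn /= map_polyX !hornerE -cE cz subrr.
Qed.

(** * Propagating irreducibility to all powers p^k *)

Lemma irredp_comp_X_odd_step (F : fieldType) (p : nat) (g : {poly F}) :
  prime p -> p != 2 -> irreducible_poly g -> irreducible_poly (g \Po 'X^p) ->
  irreducible_poly ((g \Po 'X^p) \Po 'X^p).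
Proof.
move=> pp p2 irr irr1; apply: contrapT => /(irredp_comp_Xp_or pp irr1)[h gh].
have [L dimL [z gz zL]] := irredp_FAdjoin irr.
have [c] := pth_power_of_dvdp (prime_gt0 pp) gz gh.
have odd_p : odd p by case: (even_prime pp) p2 => // ->.
rewrite -signr_odd odd_p mulN1r opprK => cz.
have : ((size (g \Po 'X^p)).-1 <= \dim {:L})%N.
  apply: (irredp_root_size (c := c) irr1).
  by rewrite /root map_comp_poly map_polyXn horner_comp hornerXn cz.
rewrite dimL size_comp_Xn leqNgt -[X in (X < _)%N]muln1 ltn_pmul2l ?prime_gt1 //.
by rewrite ltn_predRL; case: irr.
Qed.

Lemma irredp_comp_X2_step (F : fieldType) (f : {poly F}) :
  irreducible_poly (f \Po 'X^4) -> irreducible_poly (f \Po 'X^8).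
Proof.
move=> irr4.
have irr2 : irreducible_poly (f \Po 'X^2).
  by apply: (@irredp_comp_Xn_inv _ _ 2) => //; rewrite comp_poly_XnM.
have irr := irredp_comp_Xn_inv (isT : (0 < 4)%N) irr4.
apply: contrapT; rewrite -(comp_poly_XnM f 4 2) -(comp_poly_XnM f 2 2).
rewrite -(comp_poly_XnM f 2 2) in irr4.
move=> /(irredp_comp_Xp_or (isT : prime 2) irr4)[h gh].
have [L dimL [z gz zL]] := irredp_FAdjoin irr2.
have [c] := pth_power_of_dvdp (isT : (0 < 2)%N) gz gh.
rewrite sqrrN expr1n mul1r => cz.
have : ((size ((f \Po 'X^2) \Po 'X^2)).-1 <= \dim {:L})%N.
  apply: (irredp_root_size (c := c) irr4); move: gz.
  (* Here c^2 = -z; the sign disappears because f(Y^2) is even, which is what the extra level for p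
     = 2 provides. *)
  by rewrite /root !map_comp_poly !map_polyXn !horner_comp !hornerXn cz sqrrN.
rewrite dimL !size_comp_Xn leqNgt -[X in (X < _)%N]muln1 ltn_pmul2l //.
by rewrite muln_gt0 andbT ltn_predRL; case: irr.
Qed.

Lemma irredp_comp_Xpn (F : fieldType) (p : nat) (f : {poly F}) :
  prime p -> irreducible_poly (f \Po 'X^(p ^ (if p == 2%N then 2 else 1))) ->
  forall k, irreducible_poly (f \Po 'X^(p ^ k)).
Proof.
move=> pp; have p_gt0 := prime_gt0 pp.
have down i j : (i <= j)%N -> irreducible_poly (f \Po 'X^(p ^ j)) ->
    irreducible_poly (f \Po 'X^(p ^ i)).
  move=> ij irr; apply: (@irredp_comp_Xn_inv _ _ (p ^ (j - i))).
    by rewrite expn_gt0 p_gt0.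
  by rewrite comp_poly_XnM -expnD subnKC.
case: eqP => [p2|/eqP p2] irr k.
  apply: (@down k k.+2); first by rewrite (leq_trans (leqnSn _)).
  elim: k => [//|k IH]; rewrite p2 in IH *.
  (* The step from Y^4 to Y^8 is applied to f(Y^(2^k)). *)
  have -> : (2 ^ k.+3 = 2 ^ k * 8)%N by rewrite -(expnD 2 k 3) addn3.
  rewrite -comp_poly_XnM; apply: irredp_comp_X2_step.
  by rewrite comp_poly_XnM -[4%N]/(2 ^ 2)%N -expnD addn2.
apply: (@down k k.+1) => //.
elim: k => [//|k IH]; rewrite !expnSr -!comp_poly_XnM.
apply: irredp_comp_X_odd_step => //; first exact: down IH.
by rewrite comp_poly_XnM -expnSr.
Qed.

(** * Irreducibility in a Laurent polynomial ring F[y, y^-1] *)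

Section Laurent.
Variables (F K : fieldType) (iota : {rmorphism F -> K}).

HB.instance Definition _ (y : K) := GRing.RMorphism.copy (eval_at iota y)
  (horner_eval y \o map_poly iota).

Lemma eval_atX (y : K) : eval_at iota y 'X = y.
Proof. by rewrite /eval_at map_polyX hornerX. Qed.

Lemma eval_at_comp_Xn (y : K) (f : {poly F}) (q : nat) :
  eval_at iota y (f \Po 'X^q) = eval_at iota (y ^+ q) f.
Proof. by rewrite /eval_at map_comp_poly map_polyXn horner_comp hornerXn. Qed.

Variable y : K.
(** In f = r d both constant terms are nonzero, so whichever factor is a unit of S is constant.
    Keeping S abstract serves both the Laurent rings and their union. *)
Lemma irreducible_in_irredp (S : set K) (f : {poly F}) :
  (forall g, S (eval_at iota y g)) ->
  (forall g, g.[0] != 0 -> unit_in S (eval_at iota y g) -> size g = 1%N) ->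
  f.[0] != 0 -> irreducible_in S (eval_at iota y f) -> irreducible_poly f.
Proof.
move=> evS unS f0 [_ fn0 fnu fir].
have f_gt1 : (1 < size f)%N.
  rewrite ltnNge; apply/negP => /size1_polyC fE; apply: fnu; split=> //.
  exists (eval_at iota y (f`_0)^-1%:P) => //.
  rewrite fE coefC eqxx -rmorphM -polyCM divff ?rmorph1 //.
  by move: f0; rewrite fE hornerC coefC.
split=> // d d1 /[dup] df /dvdpP[r fE].
move: f0; rewrite fE hornerM mulf_eq0 => /norP[r0 d0].
case: (fir (eval_at iota y r) (eval_at iota y d)) => //.
- by rewrite fE rmorphM.
- move=> /(unS _ r0)/eqP/size_poly1P[c c0 ->].
  by rewrite mul_polyC eqp_sym eqp_scale.
- by move=> /(unS _ d0) d1'; rewrite d1' in d1.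
Qed.

Hypothesis y_tr : ~ algebraicOver iota y.

Lemma eval_at_eq0 (f : {poly F}) : (eval_at iota y f == 0) = (f == 0).
Proof.
apply/idP/eqP => [f0|->]; last by rewrite rmorph0.
by apply/eqP; apply: contra_notT y_tr => fn0; exists f.
Qed.

Lemma eval_at_inj : injective (eval_at iota y).
Proof.
by move=> f g /eqP; rewrite -subr_eq0 -rmorphB eval_at_eq0 subr_eq0 => /eqP.
Qed.

Lemma transcendental_neq0 : y != 0.
Proof. by rewrite -[X in X != _]eval_atX eval_at_eq0 polyX_eq0. Qed.

Lemma laurent_eval_at (f : {poly F}) : laurent_ring iota y (eval_at iota y f).
Proof. by exists f, 0%N; rewrite expr0 divr1. Qed.

(** A unit divides some power of Y, whereas a nonzero constant term makes f coprime to it. *)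
Lemma eval_at_unit_size (f : {poly F}) :
  f.[0] != 0 -> unit_in (laurent_ring iota y) (eval_at iota y f) -> size f = 1%N.
Proof.
move=> f0 [_ [_ [g [k ->]] fg]].
have : f %| 'X^k.
  apply/dvdpP; exists g; apply: eval_at_inj; rewrite rmorphXn rmorphM /= eval_atX.
  have yk : y ^+ k != 0 by rewrite expf_neq0 // transcendental_neq0.
  by rewrite -[LHS]mul1r -fg -!mulrA mulVf // mulr1 mulrC.
have co : coprimep f 'X^k.
  by rewrite coprimep_expr // -['X]subr0 -polyC0 coprimep_XsubC.
by rewrite -['X^k]mulr1 Gauss_dvdpr // dvdp1 => /eqP.
Qed.

Lemma laurent_irreducible (f : {poly F}) :
  f.[0] != 0 -> irreducible_poly f ->
  irreducible_in (laurent_ring iota y) (eval_at iota y f).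
Proof.
move=> f0 irr; have yn0 := transcendental_neq0.
have fn0 := irredp_neq0 irr.
split; first exact: laurent_eval_at.
- by rewrite eval_at_eq0.
- by move/(eval_at_unit_size f0) => f1; have := irr.1; rewrite f1.
have unit_of_dvd (h : {poly F}) (j N : nat) :
    h %| 'X^N -> unit_in (laurent_ring iota y) (eval_at iota y h / y ^+ j).
  case/dvdpP => w hw; split; first by exists h, j.
  exists (eval_at iota y (w * 'X^j) / y ^+ N); first by exists (w * 'X^j), N.
  have := congr1 (eval_at iota y) hw.
  rewrite !rmorphM !rmorphXn /= eval_atX => hw'.
  rewrite mulf_div mulrA [_ h * _]mulrC -hw' [y ^+ N * _]mulrC divff //.
  by rewrite mulf_neq0 ?expf_neq0.
move=> _ _ [g [i ->]] [h [j ->]] fE.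
(* Clearing denominators: if f divides one of g, h, the other one divides Y^(i+j) and hence gives a
   unit. *)
have gh : f * 'X^(i + j) = g * h.
  apply: eval_at_inj; rewrite !rmorphM rmorphXn /= eval_atX fE exprD.
  by rewrite mulf_div divfK // mulf_neq0 ?expf_neq0.
have : f %| g * h by rewrite -gh dvdp_mulr.
case/(irredp_dvdM irr)/orP => /dvdpP[w E]; [right|left];
  apply: (unit_of_dvd _ _ (i + j)%N); apply/dvdpP; exists w;
  apply: (mulfI fn0); rewrite gh E.
- by rewrite mulrA [f * w]mulrC.
- by rewrite mulrA mulrC [g * w]mulrC.
Qed.

End Laurent.

Lemma irreducible_in_mulr (K : fieldType) (S : set K) (u v a : K) :
  (forall b c, S b -> S c -> S (b * c)) -> S u -> S v -> u * v = 1 ->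
  irreducible_in S a -> irreducible_in S (a * u).
Proof.
move=> SM Su Sv uv [Sa a0 anu air].
have u0 : u != 0 by apply: contra_eqN uv => /eqP ->; rewrite mul0r eq_sym oner_eq0.
have unitM b c : S b -> S c -> unit_in S (b * c) -> unit_in S b.
  move=> Sb Sc [_ [d Sd bcd]]; split=> //; exists (c * d); first exact: SM.
  by rewrite mulrA.
split; [exact: SM | exact: mulf_neq0 | by move/unitM => H; apply/anu/H | ].
move=> b c Sb Sc E; have := air b (c * v) Sb (SM _ _ Sc Sv).
rewrite mulrA -E -mulrA uv mulr1 => /(_ erefl)[|]; first by left.
by move/unitM => H; right; apply: H.
Qed.

(** * The rings D_n and their union D *)

Section Tower.
Variables (F K : fieldType) (iota : {rmorphism F -> K}) (p : nat) (x : nat -> K).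
Hypotheses (pp : prime p) (hx : root_tower iota p x).

Local Notation ev n := (eval_at iota (x n)).
Local Notation D := (D_infty iota x).

Lemma root_tower_exp (m k : nat) : x (m + k) ^+ (p ^ k) = x m.
Proof.
elim: k => [|k IH]; first by rewrite addn0 expr1.
by rewrite addnS expnS exprM hx.2.
Qed.

Lemma root_tower_transcendental (n : nat) : ~ algebraicOver iota (x n).
Proof.
move=> alg; apply: hx.1; rewrite -(root_tower_exp 0 n) add0n.
elim: (p ^ n)%N => [|k IH]; first by rewrite expr0; apply: algebraic1.
by rewrite exprS; apply: algebraic_mul.
Qed.

Let x_neq0 n : x n != 0 := transcendental_neq0 (@root_tower_transcendental n).

Lemma eval_at_lift (m k : nat) (f : {poly F}) :
  ev m f = ev (m + k) (f \Po 'X^(p ^ k)).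
Proof. by rewrite eval_at_comp_Xn root_tower_exp. Qed.

Lemma D_lift (m k : nat) : D_ iota x m `<=` D_ iota x (m + k).
Proof.
move=> _ [g [j ->]]; exists (g \Po 'X^(p ^ k)), (p ^ k * j)%N.
by rewrite -eval_at_lift exprM root_tower_exp.
Qed.

Lemma D_leq (m n : nat) : (m <= n)%N -> D_ iota x m `<=` D_ iota x n.
Proof. by move=> mn; rewrite -(subnKC mn); apply: D_lift. Qed.

Lemma D_infty_level (m : nat) (a : K) :
  D a -> exists2 n, (m <= n)%N & D_ iota x n a.
Proof.
by case=> i _ ai; exists (m + i)%N; rewrite ?leq_addr // addnC; apply: D_lift.
Qed.

Lemma D_infty_eval (n : nat) (f : {poly F}) : D (ev n f).
Proof. by exists n => //; apply: laurent_eval_at. Qed.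

(** A common level and a common denominator reduce sums, products and gcds in D to polynomials in a
    single variable. *)
Lemma D_infty_common (a b : K) : D a -> D b ->
  exists n k (g h : {poly F}), a = ev n g / x n ^+ k /\ b = ev n h / x n ^+ k.
Proof.
move=> [i _ ai] /(D_infty_level i)[n le [h [k ->]]].
have [g [j ->]] := D_leq le ai.
exists n, (j + k)%N, (g * 'X^k), (h * 'X^j).
have xk l : x n ^+ l != 0 by rewrite expf_neq0 ?x_neq0.
rewrite !rmorphM !rmorphXn /= !eval_atX exprD; split.
  by rewrite -mulf_div divff // mulr1.
by rewrite [x n ^+ j * _]mulrC -mulf_div divff // mulr1.
Qed.

Lemma D_inftyD (a b : K) : D a -> D b -> D (a + b).
Proof.
move=> Da /(D_infty_common Da)[n [k [g [h [-> ->]]]]].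
by exists n => //; exists (g + h), k; rewrite rmorphD mulrDl.
Qed.

Lemma D_inftyM (a b : K) : D a -> D b -> D (a * b).
Proof.
move=> Da /(D_infty_common Da)[n [k [g [h [-> ->]]]]].
by exists n => //; exists (g * h), (k + k)%N; rewrite rmorphM exprD mulf_div.
Qed.

Lemma D_infty0 : D 0.
Proof. by rewrite -(rmorph0 (ev 0)); apply: D_infty_eval. Qed.

Lemma D_infty1 : D 1.
Proof. by rewrite -(rmorph1 (ev 0)); apply: D_infty_eval. Qed.

Lemma D_infty_sum (n : nat) (a : 'I_n -> K) :
  (forall i, D (a i)) -> D (\sum_i a i).
Proof.
move=> Da; apply: (big_ind D) => //; [exact: D_infty0 | exact: D_inftyD].
Qed.

Lemma D_infty_Xn (n k : nat) : D (x n ^+ k) /\ D (x n ^+ k)^-1.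
Proof.
split; first by rewrite -{1}(eval_atX iota (x n)) -rmorphXn; apply: D_infty_eval.
by exists n => //; exists 1, k; rewrite rmorph1 mul1r.
Qed.

Lemma horner0_comp_Xpn (f : {poly F}) (k : nat) : (f \Po 'X^(p ^ k)).[0] = f.[0].
Proof.
by rewrite horner_comp hornerXn expr0n gtn_eqF // expn_gt0 prime_gt0.
Qed.

(** The inverse lies in some D_i with i at least n; there f reads f(Y^(p^(i-n))), which must be
    constant, and so must f. *)
Lemma D_infty_unit_size (n : nat) (f : {poly F}) :
  f.[0] != 0 -> unit_in D (ev n f) -> size f = 1%N.
Proof.
move=> f0 [_ [b /(D_infty_level n)[i le bi] fb]].
have : size (f \Po 'X^(p ^ (i - n))) = 1%N.
  apply: (eval_at_unit_size (@root_tower_transcendental i)).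
    by rewrite horner0_comp_Xpn.
  rewrite -[i in eval_at _ (x i)](subnKC le) -eval_at_lift; split; last by exists b.
  by apply: (D_leq le); apply: laurent_eval_at.
have f_gt0 : (0 < size f)%N.
  by rewrite size_poly_gt0; apply: contraNneq f0 => ->; rewrite horner0.
move/(congr1 predn)/eqP; rewrite size_comp_Xn muln_eq0 orbC gtn_eqF ?expn_gt0 ?prime_gt0 //.
by move=> /eqP f1; rewrite -(prednK f_gt0) f1.
Qed.

Lemma irreducible_in_DP (m k : nat) (f : {poly F}) : f.[0] != 0 ->
  irreducible_in (D_ iota x (m + k)) (ev m f) <->
  irreducible_poly (f \Po 'X^(p ^ k)).
Proof.
move=> f0; have tr := @root_tower_transcendental (m + k).
rewrite (eval_at_lift m k); split=> [irr|].
  apply: (irreducible_in_irredp _ _ _ irr); rewrite ?horner0_comp_Xpn //.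
    exact: laurent_eval_at.
  exact: eval_at_unit_size.
by apply: laurent_irreducible; rewrite ?horner0_comp_Xpn.
Qed.

Lemma irreducible_in_D_inftyP (m : nat) (f : {poly F}) : f.[0] != 0 ->
  irreducible_in D (ev m f) <-> forall k, irreducible_poly (f \Po 'X^(p ^ k)).
Proof.
move=> f0; split=> [irr k|irr].
  apply: (@irreducible_in_irredp _ _ iota (x (m + k)) D).
  - exact: D_infty_eval.
  - exact: D_infty_unit_size.
  - by rewrite horner0_comp_Xpn.
  - by rewrite -eval_at_lift.
split; first exact: D_infty_eval.
- by have [] := (irreducible_in_DP m 0 f0).2 (irr 0%N).
- move/(D_infty_unit_size f0) => f1; have := (irr 0%N).1.
  by rewrite expn0 comp_polyXr f1.
move=> b c Db Dc E.
(* Both factors lie in a single D_j with j at least m, where f is already irreducible. *)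
have [i mi bi] := D_infty_level m Db; have [j ij cj] := D_infty_level i Dc.
have bj := D_leq ij bi; have mj := leq_trans mi ij.
have := (irreducible_in_DP m (j - m) f0).2 (irr _); rewrite subnKC // => -[_ _ _].
move/(_ b c bj cj E); have up a : unit_in (D_ iota x j) a -> unit_in D a.
  by move=> [aj [a' a'j aa']]; split; [exists j | exists a' => //; exists j].
by case=> /up; [left | right].
Qed.

(** * Bezout property, invertible ideals and the algebraically closed case *)

Lemma D_infty_bezout (n : nat) (a : 'I_n -> K) : (forall i, D (a i)) ->
  exists d (u v : 'I_n -> K), [/\ forall i, D (u i), forall i, D (v i),
    d = \sum_i u i * a i & forall i, a i = v i * d].
Proof.
elim: n a => [|n IH] a Da.
  by exists 0, a, a; split; rewrite ?big_ord0 //; case.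
have [d [u [v [Du Dv dE aE]]]] := IH (fun i => a (lift ord0 i)) (fun i => Da _).
have Dd : D d by rewrite dE; apply: D_infty_sum => i; apply: D_inftyM.
(* The generator d of the tail is merged with [a ord0] through a Bezout relation in F[Y] at level
   N. *)
have [N [k [g [h [gE hE]]]]] := D_infty_common (Da ord0) Dd.
have [[s t] /= E] := Bezoutp g h.
(* [Bezoutp] gives the gcd only up to a scalar, recorded as c. *)
have [c cn0 sth] : exists2 c : F, c != 0 & gcdp g h = c *: (s * g + t * h).
  have [[c1 c2] /= /andP[c10 c20] E'] := eqpP _ _ E.
  exists (c2^-1 * c1); first by rewrite mulf_neq0 ?invr_neq0.
  by rewrite -scalerA E' scalerA mulVf ?scale1r.
set e := gcdp g h in sth.
have /dvdpP[g' g'E] : e %| g := dvdp_gcdl _ _.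
have /dvdpP[h' h'E] : e %| h := dvdp_gcdr _ _.
pose S0 := ev N (c *: s); pose T0 := ev N (c *: t).
have e_sum : ev N e / x N ^+ k = S0 * a ord0 + T0 * d.
  rewrite gE hE !mulrA -mulrDl -!rmorphM -rmorphD sth.
  by rewrite -!scalerAl -scalerDr.
exists (ev N e / x N ^+ k).
exists (fun i => if unlift ord0 i is Some j then T0 * u j else S0).
exists (fun i => if unlift ord0 i is Some j then v j * ev N h' else ev N g').
split.
- move=> i; case: unliftP => [j _|_]; last exact: D_infty_eval.
  by apply: D_inftyM => //; apply: D_infty_eval.
- move=> i; case: unliftP => [j _|_]; last exact: D_infty_eval.
  by apply: D_inftyM => //; apply: D_infty_eval.
- rewrite big_ord_recl unlift_none e_sum dE mulr_sumr; congr (_ + _).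
  by apply: eq_bigr => i _; rewrite liftK mulrA.
- move=> i; case: unliftP => [j ->|->].
    by rewrite aE hE h'E rmorphM !mulrA.
  by rewrite gE g'E rmorphM mulrA.
Qed.

(** If 1 is the sum of the a_i b_i, then z in I is the sum of the a_i (b_i z) with b_i z in D, so
    the finitely many a_i generate I and the Bezout property applies. *)
Lemma invertible_ideal_principal (I : set K) :
  is_ideal D I -> invertible_ideal D I ->
  exists2 d, d != 0 & I = [set z | exists2 w, D w & z = d * w].
Proof.
move=> [ID I0 IDD IM] inv.
have [n [a [b [aI bI ab]]]] : ideal_mul I (ideal_inv D I) 1.
  by rewrite inv; apply: D_infty1.
have [d [u [v [Du Dv dE aE]]]] := D_infty_bezout (fun i => ID _ (aI i)).
have Id : I d.
  by rewrite dE; apply: (big_ind I) => // i _; apply: IM.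
exists d.
  apply: contra_eqN ab => /eqP d0; rewrite big1 ?oner_eq0 // => i _.
  by rewrite aE d0 mulr0 mul0r.
apply/seteqP; split=> [z Iz|_ [w Dw ->]]; last by rewrite mulrC; apply: IM.
exists (\sum_i v i * (b i * z)).
  by apply: D_infty_sum => i; apply: D_inftyM => //; apply: (bI i).2.
rewrite -[LHS]mul1r ab mulr_suml mulr_sumr; apply: eq_bigr => i _.
by rewrite [in LHS]aE -!mulrA [v i * (d * _)]mulrCA.
Qed.

(** If d = b c, the ideal bD contains M: it is M, and c is a unit, or it is D, and b is a unit. *)
Lemma maximal_principal_irreducible (M : set K) (d : K) :
  maximal_ideal D M -> d != 0 -> M = [set z | exists2 w, D w & z = d * w] ->
  irreducible_in D d.
Proof.
move=> [[MD M0 MDD MM] MnD Mmax] d0 ME.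
have Md : M d by rewrite ME; exists 1; rewrite ?mulr1 //; apply: D_infty1.
split=> //; first exact: MD.
  case=> _ [b Db db]; apply: MnD; apply/seteqP; split=> // z Dz.
  by rewrite ME; exists (b * z); rewrite ?mulrA ?db ?mul1r //; apply: D_inftyM.
move=> b c Db Dc dbc.
pose J := [set z | exists2 w, D w & z = b * w].
have Jideal : is_ideal D J.
  split.
  - by move=> _ [w Dw ->]; apply: D_inftyM.
  - by exists 0; rewrite ?mulr0 //; apply: D_infty0.
  - by move=> _ _ [w Dw ->] [w' Dw' ->]; exists (w + w'); rewrite ?mulrDr //; apply: D_inftyD.
  - by move=> a _ Da [w Dw ->]; exists (a * w); rewrite 1?mulrCA //; apply: D_inftyM.
have MJ : M `<=` J.
  rewrite ME => _ [w Dw ->]; exists (c * w); first exact: D_inftyM.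
  by rewrite mulrA -dbc.
have [JM|JD] := Mmax _ Jideal MJ.
  have : M b by rewrite -JM; exists 1; rewrite ?mulr1 //; apply: D_infty1.
  rewrite ME => -[w Dw bE]; right; split=> //; exists w => //.
  by apply: (mulfI d0); rewrite mulr1 mulrCA -bE mulrC -dbc.
have : J 1 by rewrite JD; apply: D_infty1.
by case=> w Dw bw; left; split=> //; exists w.
Qed.

Lemma D_infty_no_irreducible (a : K) :
  GRing.closed_field_axiom F -> ~ irreducible_in D a.
Proof.
move=> closedF irr.
have [n _ [g [k aE]]] : D a by case: irr.
have gn0 : g != 0.
  by case: irr => _ a0 _ _; apply: contraNneq a0 => g0; rewrite aE g0 rmorph0 mul0r.
(* Removing the largest power of Y from g changes a by a unit only and leaves f with f(0)
   nonzero. *)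
have [j [f f0 gE]] := multiplicity_XsubC g 0.
rewrite gn0 /= in f0; rewrite subr0 in gE.
have irr_f : irreducible_in D (ev n f).
  have xk l : x n ^+ l != 0 by rewrite expf_neq0 ?x_neq0.
  have -> : ev n f = a * (x n ^+ k / x n ^+ j).
    by rewrite aE gE rmorphM rmorphXn /= eval_atX mulrA divfK // mulfK.
  have [Dk Dk'] := D_infty_Xn n k; have [Dj Dj'] := D_infty_Xn n j.
  apply: (irreducible_in_mulr D_inftyM (v := x n ^+ j / x n ^+ k)) irr.
  - exact: D_inftyM.
  - exact: D_inftyM.
  - by rewrite mulf_div [X in _ / X]mulrC divff ?mulf_neq0.
have [f_gt1 f_irr] := (irreducible_in_D_inftyP n f0).1 irr_f 1%N.
(* A root of the irreducible f(Y^p) forces its degree p deg f to be 1. *)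
have [r rf] : exists r, root (f \Po 'X^(p ^ 1)) r.
  by apply/(@PreClosedField.closed_rootP _ closedF); rewrite gtn_eqF.
have := f_irr ('X - r%:P); rewrite size_XsubC dvdp_XsubCl => /(_ isT rf).
move/eqp_size/(congr1 predn); rewrite size_XsubC size_comp_Xn expn1 => /eqP.
by rewrite eq_sym muln_eq1 => /andP[_ /eqP p1]; have := prime_gt1 pp; rewrite p1.
Qed.

End Tower.

Theorem proposition3p4 (p : nat) (F K : fieldType) (iota : {rmorphism F -> K})
    (x : nat -> K) (hp : prime p) (hx : root_tower iota p x) :
  (forall (m : nat) (f : {poly F}),
     f.[0] != 0 ->
     irreducible_in (D_ iota x m) (eval_at iota (x m) f) ->
     [<-> irreducible_in (D_infty iota x) (eval_at iota (x m) f);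
          irreducible_in (D_ iota x (if p == 2%N then m.+2 else m.+1))
            (eval_at iota (x m) f);
          forall k : nat,
            irreducible_in (D_ iota x (m + k)%N) (eval_at iota (x m) f)])
  /\
  (GRing.closed_field_axiom F ->
     (forall a : K, ~ irreducible_in (D_infty iota x) a) /\
     (forall M : set K, maximal_ideal (D_infty iota x) M ->
        ~ invertible_ideal (D_infty iota x) M)).
Proof.
split=> [m f f0 _|closedF].
  have -> : (if p == 2%N then m.+2 else m.+1) = (m + (if p == 2%N then 2 else 1))%N.
    by case: eqP; rewrite ?addn1 ?addn2.
  tfae.
  - by move/(irreducible_in_D_inftyP hp hx m f0) => irr; apply/(irreducible_in_DP hp hx m _ f0).
  - move/(irreducible_in_DP hp hx m _ f0)/(irredp_comp_Xpn hp) => irr k.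
    exact/(irreducible_in_DP hp hx m k f0).
  - move=> irr; apply/(irreducible_in_D_inftyP hp hx m f0) => k.
    exact/(irreducible_in_DP hp hx m k f0).
have noirr a := @D_infty_no_irreducible _ _ _ _ _ hp hx a closedF.
split=> // M Mmax Minv; have [Mid _ _] := Mmax.
have [d d0 ME] := invertible_ideal_principal hx Mid Minv.
exact: noirr (maximal_principal_irreducible hx Mmax d0 ME).
Qed.
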